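(* Let $n>2$ and $t>2$ be two positive integers. Then \[\varphi(P_n\boxdot C_t)=\begin{cases} 4, & \text{if } (n,t)=(3,4),\\ 5, & \text{if either } (n=3 \text{ and } t\neq 4) \text{ or } n\in\{4,5\},\\ n-1, & \text{if } 6\leq n\leq 2t+3,\\ 2t+3, & \text{otherwise}. \end{cases}\]
   Context: All graphs are finite and simple. $P_n$ and $C_n$ denote respectively the path and the cycle with $n$ vertices. The subdivision graph $S(G)$ of a graph $G$ is obtained by inserting one new vertex into every edge of $G$. For graphs $G$ and $H$, with $V(G)=\{u_0,\ldots,u_{m-1}\}$, the subdivision-vertex neighbourhood corona (SVN corona) $G\boxdot H$ is the graph obtained from $S(G)$ by adding $m$ vertex-disjoint copies of $H$ (one for each $u_i$) and joining, for each $i$, every vertex of $N_{S(G)}(u_i)$ (the neighbourhood of $u_i$ in $S(G)$) to every vertex of the copy of $H$ associated with $u_i$. A $b$-chromatic coloring of a graph with $k$ colors is a proper coloring with colors $0,\ldots,k-1$ such that, for each color $i$, there is a vertex (a $b$-vertex) of color $i$ having, for each color $j\neq i$, a neighbour of color $j$. The $b$-chromatic number $\varphi(G)$ is the maximum $k$ for which $G$ has a $b$-chromatic coloring with $k$ colors. *)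

(* Defs.v *)
From mathcomp Require Import all_boot.

Set Implicit Arguments.
Unset Strict Implicit.
Unset Printing Implicit Defensive.

Record sgraph := SGraph {
  vertex :> finType;
  adj : rel vertex;
  adj_sym : symmetric adj;
  adj_irrefl : irreflexive adj }.

Definition path_adj (n : nat) : rel 'I_n :=
  [rel i j : 'I_n | (j == i.+1 :> nat) || (i == j.+1 :> nat)].

Lemma path_adj_sym n : symmetric (@path_adj n).
Proof. by move=> i j; rewrite /path_adj /= orbC. Qed.

Lemma path_adj_irrefl n : irreflexive (@path_adj n).
Proof. by move=> i; rewrite /path_adj /= orbb; apply/eqP/n_Sn. Qed.

Definition path_graph (n : nat) : sgraph :=
  SGraph (@path_adj_sym n) (@path_adj_irrefl n).

(* The conjunct i != j only matters for n = 1, where it removes the loop. *)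
Definition cycle_adj (n : nat) : rel 'I_n :=
  [rel i j : 'I_n | (i != j) && ((j == i.+1 %% n :> nat) || (i == j.+1 %% n :> nat))].

Lemma cycle_adj_sym n : symmetric (@cycle_adj n).
Proof. by move=> i j; rewrite /cycle_adj /= eq_sym orbC. Qed.

Lemma cycle_adj_irrefl n : irreflexive (@cycle_adj n).
Proof. by move=> i; rewrite /cycle_adj /= eqxx. Qed.

Definition cycle_graph (n : nat) : sgraph :=
  SGraph (@cycle_adj_sym n) (@cycle_adj_irrefl n).

Definition is_edge (G : sgraph) (e : {set G}) : bool :=
  [exists u : G, exists v : G, adj u v && (e == [set u; v])].

Definition edge (G : sgraph) : finType := {e : {set G} | is_edge e}.

(* [inl u] is an original vertex, [inr e] the vertex inserted into the edge e. *)
Definition subdiv_adj (G : sgraph) : rel (G + edge G)%type :=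
  fun x y => match x, y with
  | inl u, inr e | inr e, inl u => u \in val e
  | _, _ => false
  end.

Lemma subdiv_adj_sym (G : sgraph) : symmetric (@subdiv_adj G).
Proof. by case=> [u|e] [v|f]. Qed.

Lemma subdiv_adj_irrefl (G : sgraph) : irreflexive (@subdiv_adj G).
Proof. by case. Qed.

Definition subdivision (G : sgraph) : sgraph :=
  SGraph (@subdiv_adj_sym G) (@subdiv_adj_irrefl G).

(* [inr (u, h)] is the vertex h in the copy of H associated with u. *)
Definition svn_adj (G H : sgraph) : rel (subdivision G + G * H)%type :=
  fun x y => match x, y with
  | inl a, inl b => adj a b
  | inl a, inr (u, _) | inr (u, _), inl a => adj (inl u : subdivision G) a
  | inr (u, h), inr (v, k) => (u == v) && adj h k
  end.

Lemma svn_adj_sym (G H : sgraph) : symmetric (@svn_adj G H).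
Proof.
case=> [a|[u h]] [b|[v k]] //=; first exact: (@adj_sym (subdivision G)).
by rewrite eq_sym adj_sym.
Qed.

Lemma svn_adj_irrefl (G H : sgraph) : irreflexive (@svn_adj G H).
Proof.
case=> [a|[u h]] /=; first exact: (@adj_irrefl (subdivision G)).
by rewrite adj_irrefl andbF.
Qed.

Definition svn_corona (G H : sgraph) : sgraph :=
  SGraph (@svn_adj_sym G H) (@svn_adj_irrefl G H).

Definition proper_coloring (G : sgraph) (k : nat) (f : {ffun G -> 'I_k}) : bool :=
  [forall x : G, forall y : G, adj x y ==> (f x != f y)].

Definition b_vertex (G : sgraph) (k : nat) (f : {ffun G -> 'I_k}) (x : G) : bool :=
  [forall j : 'I_k, (j != f x) ==> [exists y : G, adj x y && (f y == j)]].

Definition b_coloring (G : sgraph) (k : nat) (f : {ffun G -> 'I_k}) : bool :=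
  proper_coloring f &&
  [forall i : 'I_k, exists x : G, (f x == i) && b_vertex f x].

Definition b_colorable (G : sgraph) (k : nat) : bool :=
  [exists f : {ffun G -> 'I_k}, b_coloring f].

Lemma b_colorable_leq_card (G : sgraph) (k : nat) : b_colorable G k -> k <= #|G|.
Proof.
case/existsP=> f /andP[_ /forallP fb].
rewrite -[k]card_ord; apply: leq_trans (leq_image_card f G).
apply/subset_leq_card/subsetP=> i _.
by have /existsP[x /andP[/eqP <- _]] := fb i; apply: image_f.
Qed.

(* By b_colorable_leq_card, the bound k <= #|G| loses no coloring. *)
Definition b_chromatic (G : sgraph) : nat :=
  \max_(k < #|G|.+1 | b_colorable G k) k.

(* Main.v *)
(** Upper bounds: a [b]-vertex for [k] colors has degree at least [k - 1]. The
    vertices inserted in the edges of the path have degree [2t + 2] and all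
    others have degree at most 4, so [k <= 2t + 3], and [k >= 6] forces
    [k <= n - 1]. For [(n, t) = (3, 4)] and [k = 5], a [b]-vertex in a copy of
    the cycle lies in the middle copy and its neighbours have distinct colors;
    since there must be [b]-vertices at both parities of that 4-cycle, the cycle
    and the two edge vertices would carry 6 distinct colors.

    Lower bounds: for [5 <= k <= min (n - 1, 2t + 3)] give the [i]-th edge vertex
    color [i] and the [i]-th base vertex color [i + 1], and let the colors of the
    [i]-th copy contain [i + 3, i + 5, ...] (all modulo [k]). The odd offsets at
    [i], and the odd offsets at [i + 1], which are even seen from [i], together
    reach every color but [i]. For [n <= 5] some [b]-vertices must be taken in
    the copies, and suitable 3-colorings of the cycle do this. *)

Require Import Defs.
From mathcomp Require Import all_boot.
From mathcomp Require Import zify.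

Set Implicit Arguments.
Unset Strict Implicit.
Unset Printing Implicit Defensive.

(** * Counting colors around [b]-vertices of an arbitrary graph *)

Lemma b_chromaticE (G : sgraph) k :
  b_colorable G k -> (forall m, b_colorable G m -> m <= k) -> b_chromatic G = k.
Proof.
move=> Gk Gle; apply/eqP; rewrite eqn_leq; apply/andP; split.
  by apply/bigmax_leqP => m /Gle.
have ltk : k < #|G|.+1 by rewrite ltnS b_colorable_leq_card.
exact: (@leq_bigmax_cond _ (fun i : 'I__ => b_colorable G i) _ (Ordinal ltk)).
Qed.

Section BVertex.
Variables (G : sgraph) (k : nat) (f : {ffun G -> 'I_k}).

Lemma proper_coloringP :
  reflect (forall x y, adj x y -> f x != f y) (proper_coloring f).
Proof.
apply: (iffP forallP) => [fP x y xy | fP x].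
  by have /forallP/(_ y)/implyP := fP x; apply.
by apply/forallP => y; apply/implyP/fP.
Qed.

Lemma b_vertexP x :
  reflect (forall j, j != f x -> exists2 y, adj x y & f y = j) (b_vertex f x).
Proof.
apply: (iffP forallP) => [fP j jx | fP j].
  have /implyP/(_ jx)/existsP[y /andP[xy /eqP <-]] := fP j.
  by exists y.
apply/implyP => /fP[y xy <-].
by apply/existsP; exists y; rewrite xy eqxx.
Qed.

Lemma b_vertex_cover x (s : seq G) :
  b_vertex f x -> (forall y, adj x y -> y \in s) -> forall j, j \in f x :: map f s.
Proof.
move=> /b_vertexP fx xs j; rewrite inE.
have [//|/fx[y /xs ys <-]] := eqVneq j (f x).
exact: map_f.
Qed.

Lemma b_vertex_leq x (s : seq G) :
  b_vertex f x -> (forall y, adj x y -> y \in s) -> k <= (size s).+1.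
Proof.
move=> fx /(b_vertex_cover fx) cov; rewrite -[k]card_ord -(size_map f).
apply: leq_trans (card_size (f x :: map f s)).
by apply/subset_leq_card/subsetP.
Qed.

(** The list [x :: s] has at most [k] entries and shows all [k] colors, so no color can occur twice
    in it. *)
Lemma b_vertex_uniq x (s : seq G) :
  b_vertex f x -> (forall y, adj x y -> y \in s) -> (size s).+1 <= k ->
  uniq (f x :: map f s).
Proof.
move=> fx /(b_vertex_cover fx) cov sk.
apply: (@leq_size_uniq _ (enum 'I_k)); first exact: enum_uniq.
  by move=> j _.
by rewrite /= size_map -cardE card_ord.
Qed.

Lemma b_coloring_leq (s : seq G) :
  b_coloring f -> (forall x, b_vertex f x -> x \in s) -> k <= size s.
Proof.
case/andP=> _ /forallP fb sP; rewrite -[k]card_ord -(size_map f).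
apply: leq_trans (card_size (map f s)).
apply/subset_leq_card/subsetP => i _.
by have /existsP[x /andP[/eqP <- /sP xs]] := fb i; apply: map_f.
Qed.

End BVertex.

(** * The corona of the path on [n.+2] vertices and the cycle on [t.+1] vertices *)

Section Corona.
Variables n t : nat.

Local Notation P := (path_graph n.+2).
Local Notation C := (cycle_graph t.+1).
Local Notation S := (svn_corona P C).

Definition path_edge_set i : {set P} :=
  [set (inord i : 'I_n.+2); (inord i.+1 : 'I_n.+2)].

Lemma path_edge_subproof (i : 'I_n.+1) : is_edge (path_edge_set i).
Proof.
have lt_i := ltn_ord i; apply/existsP; exists (inord i : 'I_n.+2).
apply/existsP; exists (inord i.+1 : 'I_n.+2); rewrite eqxx andbT /=.
by rewrite /path_adj /= !inordK ?eqxx //; lia.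
Qed.

Definition path_edge (i : 'I_n.+1) : edge P := 
  exist (fun e : {set P} => is_edge e) _ (path_edge_subproof i).

Lemma path_edge_surj (e : edge P) : exists i, e = path_edge i.
Proof.
case: e => e e_edge.
have /existsP[u /existsP[v /andP[uv /eqP def_e]]] := e_edge.
have [lt_u lt_v] := (ltn_ord u, ltn_ord v).
have [vu|uv'] := orP uv.
- have lt_un : u < n.+1 by move: (eqP vu); lia.
  exists (Ordinal lt_un); apply: val_inj; rewrite /= def_e /path_edge_set /=.
  by rewrite -(eqP vu) !inord_val.
- have lt_vn : v < n.+1 by move: (eqP uv'); lia.
  exists (Ordinal lt_vn); apply: val_inj; rewrite /= def_e /path_edge_set /=.
  by rewrite -(eqP uv') !inord_val setUC.
Qed.

(* The endpoints of the i-th edge sum to [2 * i + 1]. *)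
Definition path_edge_index (e : edge P) : nat :=
  (\sum_(x in val e) nat_of_ord x)./2.

Lemma path_edge_indexK i : path_edge_index (path_edge i) = i.
Proof.
have lt_i := ltn_ord i; rewrite /path_edge_index /= big_setU1 /=; last first.
  by rewrite inE -val_eqE /= !inordK; lia.
by rewrite big_set1 !inordK; lia.
Qed.

Lemma in_path_edge (u : P) (e : edge P) :
  (u \in val e) =
    (u == path_edge_index e :> nat) || (u == (path_edge_index e).+1 :> nat).
Proof.
have [i ->] := path_edge_surj e; rewrite path_edge_indexK.
by have lt_i := ltn_ord i; rewrite !inE -!val_eqE /= !inordK //; lia.
Qed.

Lemma path_edge_index_ltn e : path_edge_index e < n.+1.
Proof. by have [i ->] := path_edge_surj e; rewrite path_edge_indexK. Qed.

Lemma path_edge_inordK e : path_edge (inord (path_edge_index e)) = e.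
Proof. by have [i ->] := path_edge_surj e; rewrite path_edge_indexK inord_val. Qed.

Definition base_vertex (u : nat) : S := inl (inl (inord u : 'I_n.+2)).
Definition edge_vertex (i : nat) : S := inl (inr (path_edge (inord i))).
Definition copy_vertex (u j : nat) : S :=
  inr ((inord u : 'I_n.+2), (inord j : 'I_t.+1)).

Definition edge_nbrs (i : nat) : seq S :=
  [:: base_vertex i; base_vertex i.+1]
    ++ [seq copy_vertex i j | j <- iota 0 t.+1]
    ++ [seq copy_vertex i.+1 j | j <- iota 0 t.+1].

Lemma size_edge_nbrs i : size (edge_nbrs i) = 2 * t.+1 + 2.
Proof. by rewrite /edge_nbrs !size_cat !size_map !size_iota /=; lia. Qed.

(* The clamps [minn u n] and [u.-1] make both edge vertices coincide exactly when
   [u] is an end of the path; no [b]-vertex for 5 colors lies in such a copy. *)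
Definition copy_nbrs (u j : nat) : seq S :=
  [:: edge_vertex (minn u n); edge_vertex u.-1;
      copy_vertex u (j.+1 %% t.+1); copy_vertex u ((j + t) %% t.+1)].

Lemma edge_vertexP (e : edge P) : inl (inr e) = edge_vertex (path_edge_index e).
Proof. by rewrite /edge_vertex path_edge_inordK. Qed.

Lemma edge_nbrsP (e : edge P) (y : S) :
  adj (inl (inr e) : S) y -> y \in edge_nbrs (path_edge_index e).
Proof.
rewrite /edge_nbrs !mem_cat; case: y => [[u|//]|[u h]]; rewrite [adj _ _]/=.
- rewrite in_path_edge !inE /base_vertex => /orP[] /eqP <-; rewrite inord_val eqxx //.
  by rewrite orbT.
- have mem_copy v : copy_vertex v h \in [seq copy_vertex v j | j <- iota 0 t.+1].
    by rewrite map_f // mem_iota ltn_ord.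
  have -> : inr (u, h) = copy_vertex u h by rewrite /copy_vertex !inord_val.
  by rewrite in_path_edge => /orP[] /eqP <-; rewrite mem_copy !orbT.
Qed.

Lemma base_nbrsP (u : P) (y : S) :
  adj (inl (inl u) : S) y -> y \in [:: edge_vertex u; edge_vertex u.-1].
Proof.
case: y => [[//|e]|[//]] /=; rewrite edge_vertexP in_path_edge !inE.
by move=> /orP[] /eqP ->; rewrite eqxx ?orbT.
Qed.

Lemma cycle_adj_nbrs (h k : 'I_t.+1) :
  cycle_adj h k -> (k == h.+1 %% t.+1 :> nat) || (k == (h + t) %% t.+1 :> nat).
Proof.
case/andP=> _ /orP[-> // | /eqP ->].
(* Adding [t] modulo [t.+1] subtracts 1, so [h + t] is the predecessor of [h] on the cycle. *)
by rewrite modnDml addSnnS modnDr (modn_small (ltn_ord k)) eqxx orbT.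
Qed.

Lemma copy_nbrsP (u : P) (h : C) (y : S) :
  adj (inr (u, h) : S) y -> y \in copy_nbrs u h.
Proof.
rewrite /copy_nbrs !inE; case: y => [[//|e]|[v k]] /=.
  rewrite edge_vertexP in_path_edge => /orP[] /eqP ->; last by rewrite eqxx orbT.
  by rewrite (minn_idPl _) ?eqxx // -ltnS path_edge_index_ltn.
case/andP=> /eqP <- /cycle_adj_nbrs; rewrite /copy_vertex !inord_val.
by move=> /orP[] /eqP <-; rewrite inord_val eqxx ?orbT.
Qed.

Lemma cycle_adj_succ j :
  0 < t -> cycle_adj (inord (j %% t.+1) : 'I_t.+1) (inord (j.+1 %% t.+1)).
Proof.
move=> ht; rewrite /cycle_adj /= -val_eqE /= !inordK ?ltn_pmod //.
rewrite -[(j %% t.+1).+1]addn1 modnDml addn1 eqxx andbT.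
by rewrite -{1}[j]addn0 -[j.+1]addn1 eqn_modDl mod0n modn_small.
Qed.


(** * Upper bounds on the number of colors *)

Section UpperBound.
Variables (k : nat) (f : {ffun S -> 'I_k}).

Lemma b_coloring_leq_deg : 2 < t.+1 -> b_coloring f -> k <= 2 * t.+1 + 3.
Proof.
move=> ht fb; case: (posnP k) => [-> // | k_gt0].
case/andP: fb => _ /forallP/(_ (Ordinal k_gt0))/existsP[x /andP[_]].
case: x => [[u|e]|[u h]] /b_vertex_leq.
- by move=> /(_ _ (@base_nbrsP u)) /=; lia.
- by move=> /(_ _ (@edge_nbrsP e)); rewrite size_edge_nbrs; lia.
- by move=> /(_ _ (@copy_nbrsP u h)) /=; lia.
Qed.

Lemma b_coloring_leq_edges : 5 < k -> b_coloring f -> k <= n.+1.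
Proof.
move=> k_gt5 /b_coloring_leq le_k.
have := le_k [seq edge_vertex i | i <- iota 0 n.+1].
rewrite size_map size_iota; apply=> x.
case: x => [[u|e]|[u h]].
- by move/b_vertex_leq => /(_ _ (@base_nbrsP u)) /=; lia.
- by move=> _; rewrite edge_vertexP map_f // mem_iota /= path_edge_index_ltn.
- by move/b_vertex_leq => /(_ _ (@copy_nbrsP u h)) /=; lia.
Qed.

Lemma copy_b_vertex_uniq u j :
  u < n.+2 -> j < t.+1 -> 4 < k -> b_vertex f (copy_vertex u j) ->
  uniq [seq f y | y <- copy_vertex u j :: copy_nbrs u j].
Proof.
move=> lt_u lt_j k_gt4 /b_vertex_uniq/(_ (@copy_nbrsP (inord u) (inord j)) k_gt4).
by rewrite !inordK.
Qed.

End UpperBound.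

(** * Colorings of the corona given by numerical sequences *)

Section Coloring.
Variables (k : nat) (a b : nat -> nat) (c : nat -> nat -> nat).

Definition corona_coloring : {ffun S -> 'I_k.+1} :=
  [ffun x : S => inord match x with
    | inl (inl u) => b (u : 'I_n.+2)
    | inl (inr e) => a (path_edge_index e)
    | inr (u, h) => c (u : 'I_n.+2) (h : 'I_t.+1)
    end].

(** Arithmetic form of the [i]-th edge vertex being a [b]-vertex: its neighbours are two base
    vertices and two copies. *)
Definition edge_dominant i :=
  [/\ i < n.+1 & forall y, y < k.+1 -> y != a i ->
    [\/ y = b i, y = b i.+1, exists2 j, j < t.+1 & y = c i j
      | exists2 j, j < t.+1 & y = c i.+1 j]].

(** The copy [i.+1] with [i < n] belongs to an inner vertex of the path, so the edges [i] and [i.+1]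
    both exist. The vertex sits at position [j.+1], which makes its predecessor [j] without
    subtraction. *)
Definition copy_dominant i j :=
  [/\ i < n & forall y, y < k.+1 -> y != c i.+1 (j.+1 %% t.+1) ->
    y \in [:: a i; a i.+1; c i.+1 (j %% t.+1); c i.+1 (j.+2 %% t.+1)]].

Hypothesis ht : 0 < t.
Hypotheses (a_lt : forall i, a i < k.+1) (b_lt : forall i, b i < k.+1).
Hypothesis c_lt : forall i j, j < t.+1 -> c i j < k.+1.
Hypothesis ab : forall i, i < n.+1 -> a i != b i.
Hypothesis abS : forall i, i < n.+1 -> a i != b i.+1.
Hypothesis ac : forall i j, j < t.+1 -> a i != c i j.
Hypothesis acS : forall i j, j < t.+1 -> a i != c i.+1 j.
Hypothesis cc : forall i j, j < t.+1 -> c i j != c i (j.+1 %% t.+1).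

Hypothesis dominant : forall y, y < k.+1 ->
  (exists2 i, a i = y & edge_dominant i) \/
  (exists i j, c i.+1 (j.+1 %% t.+1) = y /\ copy_dominant i j).

Lemma corona_coloring_proper : proper_coloring corona_coloring.
Proof.
pose ok x y := corona_coloring x != corona_coloring y.
have okC x y : ok x y = ok y x by rewrite /ok eq_sym.
have edge_base u (e : edge P) : u \in val e -> ok (inl (inl u)) (inl (inr e)).
  rewrite okC /ok !ffunE -val_eqE /= !inordK // in_path_edge.
  by case/orP=> /eqP ->; rewrite ?ab ?abS ?path_edge_index_ltn.
have edge_copy u (h : C) (e : edge P) : u \in val e -> ok (inr (u, h)) (inl (inr e)).
  rewrite okC /ok !ffunE -val_eqE /= !inordK ?c_lt ?ltn_ord //.
  rewrite in_path_edge.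
  by case/orP=> /eqP ->; rewrite ?ac ?acS //; apply: ltn_ord.
have copy_copy u (h l : 'I_t.+1) : l = h.+1 %% t.+1 :> nat ->
    ok (inr (u, h)) (inr (u, l)).
  move=> def_l; rewrite /ok !ffunE -val_eqE /= !inordK ?c_lt ?ltn_ord //.
  by rewrite def_l cc // ltn_ord.
apply/proper_coloringP => x y; rewrite -/(ok x y).
case: x => [[u|e]|[u h]]; case: y => [[v|e']|[v l]] //=.
- exact: edge_base.
- by rewrite okC; apply: edge_base.
- by rewrite okC; apply: edge_copy.
- exact: edge_copy.
case/andP=> /eqP <- /andP[_ /orP[] /eqP]; first exact: copy_copy.
by rewrite okC; apply: copy_copy.
Qed.

Lemma corona_coloring_base u :
  u < n.+2 -> corona_coloring (base_vertex u) = inord (b u).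
Proof. by move=> lt_u; rewrite ffunE /= inordK. Qed.

Lemma corona_coloring_edge i :
  i < n.+1 -> corona_coloring (edge_vertex i) = inord (a i).
Proof. by move=> lt_i; rewrite ffunE /= path_edge_indexK inordK. Qed.

Lemma corona_coloring_copy u j : u < n.+2 -> j < t.+1 ->
  corona_coloring (copy_vertex u j) = inord (c u j).
Proof. by move=> lt_u lt_j; rewrite ffunE /= !inordK. Qed.

Lemma corona_coloring_edge_b i :
  edge_dominant i -> b_vertex corona_coloring (edge_vertex i).
Proof.
case=> lt_i cov; apply/b_vertexP => y.
rewrite corona_coloring_edge // -val_eqE /= inordK // => /(cov _ (ltn_ord y)).
have mem_e u : (u == i) || (u == i.+1) ->
    (inord u : 'I_n.+2) \in val (path_edge (inord i)).
  move=> ui; rewrite in_path_edge path_edge_indexK !inordK //.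
  by case/orP: ui => /eqP ->; lia.
case=> [yb | yb | [j lt_j yc] | [j lt_j yc]].
- exists (base_vertex i); first by rewrite /= mem_e ?eqxx.
  by rewrite corona_coloring_base ?[LHS]inord_val -?yb ?inord_val //; lia.
- exists (base_vertex i.+1); first by rewrite /= mem_e ?eqxx ?orbT.
  by rewrite corona_coloring_base -?yb ?inord_val //; lia.
- exists (copy_vertex i j); first by rewrite /= mem_e ?eqxx.
  by rewrite corona_coloring_copy -?yc ?inord_val //; lia.
- exists (copy_vertex i.+1 j); first by rewrite /= mem_e ?eqxx ?orbT.
  by rewrite corona_coloring_copy -?yc ?inord_val //; lia.
Qed.

Lemma corona_coloring_copy_b i j :
  copy_dominant i j -> b_vertex corona_coloring (copy_vertex i.+1 (j.+1 %% t.+1)).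
Proof.
case=> lt_i cov; apply/b_vertexP => y.
have lt_mod m : m %% t.+1 < t.+1 by rewrite ltn_pmod.
rewrite corona_coloring_copy ?lt_mod //; last by lia.
rewrite -val_eqE /= inordK ?c_lt // => /(cov _ (ltn_ord y)).
have in_e l : (l == i) || (l == i.+1) ->
    (inord i.+1 : 'I_n.+2) \in val (path_edge (inord l)).
  by move=> li; rewrite in_path_edge path_edge_indexK !inordK //; lia.
rewrite !inE => /or4P[] /eqP def_y.
- exists (edge_vertex i); first by rewrite /= in_e ?eqxx.
  by rewrite corona_coloring_edge -?def_y ?inord_val //; lia.
- exists (edge_vertex i.+1); first by rewrite /= in_e ?eqxx ?orbT.
  by rewrite corona_coloring_edge -?def_y ?inord_val //; lia.
- exists (copy_vertex i.+1 (j %% t.+1)).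
    by apply/andP; split=> //; rewrite cycle_adj_sym; apply: cycle_adj_succ.
  by rewrite corona_coloring_copy -?def_y ?inord_val //; lia.
- exists (copy_vertex i.+1 (j.+2 %% t.+1)).
    by apply/andP; split=> //; apply: cycle_adj_succ.
  by rewrite corona_coloring_copy -?def_y ?inord_val //; lia.
Qed.

Lemma b_colorable_corona : b_colorable S k.+1.
Proof.
apply/existsP; exists corona_coloring; rewrite /b_coloring corona_coloring_proper.
apply/forallP => y; case: (dominant (ltn_ord y)) => [[i def_y dom]|[i [j [def_y dom]]]].
- apply/existsP; exists (edge_vertex i).
  rewrite corona_coloring_edge_b // andbT corona_coloring_edge; last by case: dom.
  by rewrite def_y inord_val.
- apply/existsP; exists (copy_vertex i.+1 (j.+1 %% t.+1)).
  rewrite corona_coloring_copy_b // andbT corona_coloring_copy ?ltn_pmod //.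
    by rewrite def_y inord_val.
  by case: dom => lt_i _; lia.
Qed.

End Coloring.
End Corona.

(** * Short paths: colorings with [b]-vertices in the copies *)

(* For [t = 1 mod 3] the last vertex would clash with the first one. *)
Definition cycle3 (t j : nat) :=
  if (j.+1 == t) && (t %% 3 == 1) then 1 else j %% 3.

Lemma cycle3E t j : (j.+1 != t) || (t %% 3 != 1) -> cycle3 t j = j %% 3.
Proof. by rewrite /cycle3; case: ifP => //; lia. Qed.

Lemma cycle3_proper t j : 2 < t -> j < t -> cycle3 t j != cycle3 t (j.+1 %% t).
Proof.
move=> ht lt_j; rewrite /cycle3; have [def_t|neq_j] := eqVneq j.+1 t.
  by rewrite def_t modnn; do ?[case: ifP => ?]; lia.
by rewrite (@modn_small j.+1 t) /=; do ?[case: ifP => ?]; lia.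
Qed.

Lemma cycle3_lt t j : cycle3 t j < 3.
Proof. by rewrite /cycle3; case: ifP => _; rewrite ?ltn_pmod. Qed.

(** The two edge vertices get 0 and 1, and all copies repeat [s] shifted by 2. Each end of the path
    gets the color of the far edge vertex, so both edge vertices are [b]-vertices; the remaining
    ones lie in the middle copy. *)
Lemma b_colorable_path3 t q (s : nat -> nat) :
  0 < t -> 0 < q -> (forall j, j < t.+1 -> s j < q) ->
  (forall j, j < t.+1 -> s j != s (j.+1 %% t.+1)) ->
  (forall y, y < q -> exists j, s (j.+1 %% t.+1) = y /\
     forall z, z < q -> z != y -> z \in [:: s (j %% t.+1); s (j.+2 %% t.+1)]) ->
  b_colorable (svn_corona (path_graph 3) (cycle_graph t.+1)) q.+2.
Proof.
move=> ht q_gt0 s_lt s_proper s_dom.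
have s_onto y : 1 < y -> y < q.+2 -> exists2 j, j < t.+1 & y = (s j).+2.
  case: y => [|[|y]] // _ lt_y; have [j [<- _]] := s_dom y lt_y.
  by exists (j.+1 %% t.+1); rewrite ?ltn_pmod.
apply: (@b_colorable_corona 1 t q.+1 (fun i => i %% 2) (nth 0 [:: 1; 2; 0])
  (fun _ j => (s j).+2)) => //.
- by move=> i /=; lia.
- by case=> [|[|[|i]]] //; rewrite nth_default.
- by case=> [|[|i]].
- by case=> [|[|i]].
- by move=> i j _ /=; lia.
- by move=> i j _ /=; lia.
case=> [|[|y]] lt_y.
- left; exists 0 => //; split=> // - [|[|y]] // y_lt _; first by constructor 1.
  by constructor 3; apply: s_onto.
- left; exists 1 => //; split=> // - [|[|y]] // y_lt _; first by constructor 2.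
  by constructor 3; apply: s_onto.
- right; have [j [def_y dom]] := s_dom y lt_y; exists 0, j; split; first by rewrite def_y.
  split=> // - [|[|z]] // z_lt; rewrite def_y => /(dom _ z_lt).
  by rewrite !inE !eqSS.
Qed.

Lemma b_colorable_path3_5 t : 2 < t -> t != 4 ->
  b_colorable (svn_corona (path_graph 3) (cycle_graph t)) 5.
Proof.
case: t => // t ht t4; apply: (@b_colorable_path3 t 3 (cycle3 t.+1)) => //.
- by lia.
- by move=> j _; apply: cycle3_lt.
- by move=> j; apply: cycle3_proper.
have c0 : cycle3 t.+1 0 = 0 by rewrite cycle3E; lia.
have c1 : cycle3 t.+1 1 = 1 by rewrite cycle3E; lia.
have c2 : cycle3 t.+1 2 = 2 by rewrite cycle3E; lia.
(* The triangle is computed directly. A cycle of length at least 5 starts with 0, 1, 2, 0, 1, whose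
   three inner positions each see both other colors. *)
have [t3 | t5] : t = 2 \/ 3 < t by lia.
  rewrite t3; case=> [|[|[|y]]] // _; [exists 2|exists 0|exists 1];
  by split=> // - [|[|[|z]]].
have c3 : cycle3 t.+1 3 = 0 by rewrite cycle3E; lia.
have c4 : cycle3 t.+1 4 = 1 by rewrite cycle3E; lia.
have mod1 : 1 %% t.+1 = 1 by rewrite modn_small; lia.
have mod2 : 2 %% t.+1 = 2 by rewrite modn_small; lia.
have mod3 : 3 %% t.+1 = 3 by rewrite modn_small; lia.
have mod4 : 4 %% t.+1 = 4 by rewrite modn_small; lia.
case=> [|[|[|y]]] // _; [exists 2|exists 0|exists 1];
  rewrite ?(mod0n, mod1, mod2, mod3, mod4, c0, c1, c2, c3, c4);
  by split=> // - [|[|[|z]]].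
Qed.

Lemma b_colorable_path3_4 :
  b_colorable (svn_corona (path_graph 3) (cycle_graph 4)) 4.
Proof.
apply: (@b_colorable_path3 3 2 (modn^~ 2)) => //.
- by move=> j _; rewrite ltn_pmod.
- by move=> j _ /=; lia.
case=> [|[|y]] // _; [exists 1|exists 0]; by split=> // - [|[|z]].
Qed.

Lemma b_colorable_5 n t : 1 < n -> 2 < t ->
  b_colorable (svn_corona (path_graph n.+2) (cycle_graph t)) 5.
Proof.
case: t => // t hn ht.
(* On copy [i], class 0 takes the one color below 3 that the edges [i - 1] and [i] avoid. Classes 1
   and 2 take 3 and 4, swapped with the parity of [i], so that position 1 has color 3 in copy 1 and
   color 4 in copy 2. *)
pose c i j := if cycle3 t.+1 j == 0 then i.+1 %% 3
  else 3 + (odd i (+) (cycle3 t.+1 j == 1)).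
have c_0 i : c i 0 = i.+1 %% 3 by rewrite /c cycle3E ?ifT //; lia.
have c_1 i : c i 1 = 3 + ~~ odd i.
  by rewrite /c (_ : cycle3 _ 1 = 1) ?addbT // cycle3E; lia.
have c_2 i : c i 2 = 3 + odd i.
  by rewrite /c (_ : cycle3 _ 2 = 2) ?addbF // cycle3E; lia.
have mod1 : 1 %% t.+1 = 1 by rewrite modn_small; lia.
have mod2 : 2 %% t.+1 = 2 by rewrite modn_small; lia.
apply: (@b_colorable_corona n t 4 (fun i => i %% 3) (fun i => i.+1 %% 3) c).
- by lia.
- by move=> i /=; lia.
- by move=> i /=; lia.
- by move=> i j _; rewrite /c; case: ifP => _; lia.
- by move=> i _ /=; lia.
- by move=> i _ /=; lia.
- by move=> i j _; rewrite /c; case: ifP => _; lia.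
- by move=> i j _; rewrite /c; case: ifP => _; lia.
- move=> i j lt_j; have := cycle3_proper ht lt_j.
  have := cycle3_lt t.+1 (j.+1 %% t.+1); have := cycle3_lt t.+1 j; rewrite /c.
  case: (cycle3 _ j) => [|[|[|x]]] //; case: (cycle3 _ _) => [|[|[|y]]] // _ _ _;
  case: (odd i) => /=; lia.
case=> [|[|[|[|[|y]]]]] // _.
- left; exists 0 => //; split; first by lia.
  case=> [|[|[|[|[|z]]]]] // _ _;
    [constructor 1|constructor 2|constructor 4|constructor 4] => //.
  + by exists 1; rewrite ?c_1; lia.
  + by exists 2; rewrite ?c_2; lia.
- left; exists 1 => //; split; first by lia.
  case=> [|[|[|[|[|z]]]]] // _ _;
    [constructor 2|constructor 1|constructor 3|constructor 3] => //.
  + by exists 1; rewrite ?c_1; lia.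
  + by exists 2; rewrite ?c_2; lia.
- left; exists 2 => //; split; first by lia.
  case=> [|[|[|[|[|z]]]]] // _ _;
    [constructor 1|constructor 2|constructor 3|constructor 3] => //.
  + by exists 2; rewrite ?c_2; lia.
  + by exists 1; rewrite ?c_1; lia.
- right; exists 0, 0; rewrite mod1 c_1; split=> //; split; first by lia.
  by rewrite mod1 mod2 mod0n c_0 c_1 c_2; case=> [|[|[|[|[|z]]]]].
- right; exists 1, 0; rewrite mod1 c_1; split=> //; split; first by lia.
  by rewrite mod1 mod2 mod0n c_0 c_1 c_2; case=> [|[|[|[|[|z]]]]].
Qed.

(** * Long paths: the cyclic coloring *)

Lemma modn_offset_neq K i o o' :
  o < K -> o' < K -> o != o' -> (i + o) %% K != (i + o') %% K.
Proof. by move=> lt_o lt_o'; rewrite eqn_modDl !modn_small. Qed.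

Lemma modn_offset K x y :
  x < K -> y < K -> y != x -> exists d, [/\ 0 < d, d < K & y = (x + d) %% K].
Proof.
move=> lt_x lt_y neq; have [lt_yx | lt_xy | eq_xy] := ltngtP y x; last by lia.
  exists (y + K - x); split; try lia.
  by rewrite (_ : x + _ = y + K) ?modnDr ?modn_small //; lia.
exists (y - x); split; try lia.
by rewrite subnKC ?modn_small //; lia.
Qed.

Section CyclicColoring.
Variables (n t k : nat).
Hypotheses (k_ge5 : 5 <= k) (k_len : k <= n.+1) (k_le : k <= 2 * t.+1 + 3) (ht : 1 < t).

(* The cap at [k - 2] matters for even [k], where the color [i - 1] needed by the
   [i]-th edge vertex can only come from the copy [i + 1], at offset [k - 2].
   Positions from [offset_count] on are filled alternately with 1 and 2. *)
Definition offset_count := k./2.-1.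
Definition copy_offset j :=
  if j < offset_count then minn (2 * j + 3) (k - 2) else 1 + odd (j - offset_count).

(** On copy [i], offsets 0 and [k - 1] are the colors of the adjacent edge vertices [i] and
    [i - 1]. *)
Lemma copy_offset_bounds j : 0 < copy_offset j <= k - 2.
Proof. by rewrite /copy_offset; case: ifP => _; lia. Qed.

Lemma copy_offset_proper j :
  j < t.+1 -> copy_offset j != copy_offset (j.+1 %% t.+1).
Proof.
move=> lt_j; have [->|neq_j] := eqVneq j t.
  rewrite modnn /copy_offset /offset_count; do ?[case: ifP => ?]; lia.
rewrite modn_small; last by lia.
rewrite /copy_offset /offset_count; do ?[case: ifP => ?]; lia.
Qed.

Lemma copy_offset_odd d : odd d -> 3 <= d <= k - 2 ->
  exists2 j, j < t.+1 & copy_offset j = d.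
Proof.
move=> d_odd d_le; exists ((d - 3)./2); first by lia.
rewrite /copy_offset /offset_count; do ?[case: ifP => ?]; lia.
Qed.

Lemma copy_offset_last : exists2 j, j < t.+1 & copy_offset j = k - 2.
Proof.
exists (offset_count.-1); rewrite /copy_offset /offset_count; do ?[case: ifP => ?]; lia.
Qed.

Lemma b_colorable_cyclic :
  b_colorable (svn_corona (path_graph n.+2) (cycle_graph t.+1)) k.
Proof.
have def_k : k = k.-1.+1 by lia.
rewrite def_k.
have lt_mod x : x %% k < k.-1.+1 by rewrite -def_k ltn_pmod; lia.
apply: (@b_colorable_corona n t k.-1 (fun i => (i + 0) %% k) (fun i => (i + 1) %% k)
  (fun i j => (i + copy_offset j) %% k)) => //.
- by lia.
- by move=> i _; apply: modn_offset_neq; lia.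
- by move=> i _; rewrite -addn1 -addnA; apply: modn_offset_neq; lia.
- by move=> i j _; have := copy_offset_bounds j => ?; apply: modn_offset_neq; lia.
- move=> i j _; have := copy_offset_bounds j => ?; rewrite -addn1 -addnA.
  by apply: modn_offset_neq; lia.
- move=> i j /copy_offset_proper neq.
  have := copy_offset_bounds j; have := copy_offset_bounds (j.+1 %% t.+1) => ? ?.
  by apply: modn_offset_neq; lia.
rewrite -def_k => x lt_x; left; exists x; first by rewrite addn0 modn_small.
split=> [|y lt_y]; first by lia.
rewrite addn0 (modn_small lt_x) => /(modn_offset lt_x)[|d [d_gt0 lt_d ->]]; first by lia.
have [d_odd|d_even] := boolP (odd d).
  have [->|d_neq1] := eqVneq d 1; first by constructor 1.
  have [d_le|d_gt] := leqP d (k - 2).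
    have [|j lt_j <-] := copy_offset_odd d_odd; first by lia.
    by constructor 3; exists j.
  (* Here [d = k - 1], the color of the previous edge vertex, which copy [i] itself cannot
     contain. *)
  have [j lt_j def_j] := copy_offset_last; constructor 4; exists j => //.
  by rewrite def_j; congr (_ %% _); lia.
have [->|d_neq2] := eqVneq d 2; first by constructor 2; congr (_ %% _); lia.
have [| |j lt_j def_j] := @copy_offset_odd d.-1; [by lia|by lia|].
by constructor 4; exists j => //; rewrite def_j; congr (_ %% _); lia.
Qed.

End CyclicColoring.

(** * The exceptional pair: five colors fail for [(n, t) = (3, 4)] *)

Lemma path3_cycle4_not_5 :
  ~~ b_colorable (svn_corona (path_graph 3) (cycle_graph 4)) 5.
Proof.
apply/negP => /existsP[f fb].
pose E i := f (edge_vertex 1 3 i); pose v j := f (copy_vertex 1 3 1 j).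
have dom_uniq j : j < 4 -> b_vertex f (copy_vertex 1 3 1 j) ->
    uniq [:: v j; E 1; E 0; v (j.+1 %% 4); v ((j + 3) %% 4)].
  by move=> lt_j /copy_b_vertex_uniq; apply.
have dom_parity p : exists2 j, j < 4 /\ odd j = p & b_vertex f (copy_vertex 1 3 1 j).
  have [/existsP[j /andP[/eqP jp jb]]|] :=
    boolP [exists j : 'I_4, (odd j == p) && b_vertex f (copy_vertex 1 3 1 j)].
    by exists (nat_of_ord j).
  rewrite negb_exists => /forallP no_dom.
  (* Without a [b]-vertex at parity [p] only four candidates remain, too few for five colors. Read
     as a number, [~~ p] is the first position of the other parity. *)
  have := @b_coloring_leq _ _ _ [:: edge_vertex 1 3 0; edge_vertex 1 3 1;
    copy_vertex 1 3 1 (~~ p); copy_vertex 1 3 1 (~~ p).+2] fb.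
  suff cov x : b_vertex f x -> x \in [:: edge_vertex 1 3 0; edge_vertex 1 3 1;
    copy_vertex 1 3 1 (~~ p); copy_vertex 1 3 1 (~~ p).+2] by move=> /(_ cov).
  case: x => [[u|e]|[u h]].
  - by move=> /b_vertex_leq/(_ (@base_nbrsP 1 3 u)).
  - move=> _; have := path_edge_index_ltn e.
    by rewrite edge_vertexP; case: (path_edge_index e) => [|[|i]] //;
    rewrite !inE eqxx ?orbT.
  have -> : inr (u, h) = copy_vertex 1 3 u h by rewrite /copy_vertex !inord_val.
  have uniq_uh := @copy_b_vertex_uniq 1 3 5 f _ _ (ltn_ord u) (ltn_ord h) isT.
  case: u uniq_uh => [[|[|[|u]]]] //= lt_u uniq_uh hb.
  - by move: (uniq_uh hb); rewrite !inE eqxx ?orbT ?andbF.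
  - have := no_dom h; rewrite hb andbT.
    by case: h {uniq_uh hb} => [[|[|[|[|h]]]]] //= _;
    case: p {no_dom} => //= _; rewrite !inE eqxx ?orbT.
  - by move: (uniq_uh hb); rewrite !inE eqxx ?orbT ?andbF.
have v_succ j : v (j %% 4) != v (j.+1 %% 4).
  have /andP[/proper_coloringP f_proper _] := fb; apply: f_proper.
  by rewrite /= eqxx; apply: (@cycle_adj_succ 3).
have := (v_succ 0, v_succ 1, v_succ 2, v_succ 3).
have [j0 [lt_j0 j0_even] /(dom_uniq _ lt_j0)] := dom_parity false.
have [j1 [lt_j1 j1_odd] /(dom_uniq _ lt_j1)] := dom_parity true.
clearbody E v; clear dom_uniq dom_parity v_succ.
(* The even [b]-vertex separates the two odd positions, its neighbours, and the odd one separates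
   the two even positions. Adjacent positions differ by properness. *)
have uniq6 : uniq [:: v j1; E 1; E 0; v (j1.+1 %% 4); v ((j1 + 3) %% 4)] ->
    uniq [:: v j0; E 1; E 0; v (j0.+1 %% 4); v ((j0 + 3) %% 4)] ->
    [&& v 0 != v 1, v 1 != v 2, v 2 != v 3 & v 3 != v 0] ->
    uniq [:: E 0; E 1; v 0; v 1; v 2; v 3].
  case: j0 lt_j0 j0_even => [|[|[|[|j0]]]] // _ _;
  case: j1 lt_j1 j1_odd => [|[|[|[|j1]]]] // _ _;
  rewrite /= !inE !negb_or => uniq1 uniq0 v_neq; rewrite !andbT;
  repeat match goal with H : is_true (_ && _) |- _ => case/andP: H => ? ? end;
  by do !(apply/andP; split); rewrite // eq_sym.
move=> uniq1 uniq0 [[[v01 v12] v23] v30]; have := uniq6 uniq1 uniq0.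
rewrite v01 v12 v23 v30 => /(_ isT).
move/card_uniqP => card6.
by have := max_card [in [:: E 0; E 1; v 0; v 1; v 2; v 3]]; rewrite card6 card_ord.
Qed.

Theorem theorem7 (n t : nat) (hn : 2 < n) (ht : 2 < t) :
  b_chromatic (svn_corona (path_graph n) (cycle_graph t)) =
    if (n == 3) && (t == 4) then 4
    else if ((n == 3) && (t != 4)) || (n \in [:: 4; 5]) then 5
    else if 6 <= n <= 2 * t + 3 then n - 1
    else 2 * t + 3.
Proof.
case: n t hn ht => [|[|[|n]]] // [|t] // _ ht.
have ub_deg k : b_colorable (svn_corona (path_graph n.+3) (cycle_graph t.+1)) k ->
    k <= 2 * t.+1 + 3.
  by case/existsP => f /b_coloring_leq_deg; apply.
have ub_edges k : b_colorable (svn_corona (path_graph n.+3) (cycle_graph t.+1)) k ->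
    5 < k -> k <= n.+2.
  by case/existsP => f fb /b_coloring_leq_edges; apply; apply: fb.
rewrite !inE; case: ifP => [/andP[/eqP n0 /eqP t4]|not34].
  move: n0 t4 ub_edges => [->] [->] ub_edges; apply: b_chromaticE b_colorable_path3_4 _ => k fk.
  have k_neq5 : k != 5.
    by apply/eqP => k5; move: fk; rewrite k5; apply/negP/path3_cycle4_not_5.
  by have := ub_edges k fk; lia.
case: ifP => [small | large].
  (* More than 5 colors would require [k <= n.+2], but here [n.+2 <= 4]. *)
  apply: b_chromaticE => [|k /ub_edges]; last by lia.
  have [n0|n_gt0] := posnP n; last by apply: b_colorable_5; lia.
  by move: not34; rewrite n0 /= => /negbT; apply: b_colorable_path3_5.
case: ifP => [len | len]; apply: b_chromaticE.
- by apply: b_colorable_cyclic; lia.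
- by move=> k /ub_edges; lia.
- by apply: b_colorable_cyclic; lia.
- exact: ub_deg.
Qed.
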